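(* Let $0<\alpha\le 2/3$, $0<\beta<1/2$, $\alpha<\gamma$, $1/2+\beta\le\gamma<1$, $s\ge 0$, and set $c=6^{-3/(\alpha\beta)}$. Then there exists $n_0$ (depending on $\alpha,\beta,\gamma,s$) such that for every $n\ge n_0$: if $G$ is a graph of order $n$ with \[ q(G)>2\gamma n-\frac{s}{n}\quad\text{and}\quad \delta(G)\le(\gamma-\alpha)n, \] then there exists an induced subgraph $H\subseteq G$ with $|H|>cn$ satisfying \[ q(H)>2\gamma|H|\quad\text{and}\quad \delta(H)>(\gamma-\alpha)|H|. \]
   Context: All graphs are finite and simple. $q(G)$ denotes the largest eigenvalue of the signless Laplacian $Q(G)=D(G)+A(G)$ ($D(G)$ the diagonal degree matrix, $A(G)$ the adjacency matrix). $\delta(G)$ is the minimum degree and $|H|$ the number of vertices of $H$. *)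

(* Defs.v *)
From HB Require Import structures.
From mathcomp Require Import all_boot all_order all_algebra.
From mathcomp Require Import all_classical all_reals all_analysis.
Set Implicit Arguments. Unset Strict Implicit. Unset Printing Implicit Defensive.
Import Order.TTheory GRing.Theory Num.Theory.
Local Open Scope ring_scope.

Definition simple_graph (n : nat) (e : rel 'I_n) : Prop :=
  symmetric e /\ irreflexive e.

Definition ideg (n : nat) (e : rel 'I_n) (S : {set 'I_n}) (v : 'I_n) : nat :=
  #|[set u in S | e v u]|.

(* minimum degree of G[S] (for S empty this is 0) *)
Definition imindeg (n : nat) (e : rel 'I_n) (S : {set 'I_n}) : nat :=
  \big[minn/#|S|]_(v in S) ideg e S v.

Definition isignless (R : realType) (n : nat) (e : rel 'I_n) (S : {set 'I_n})
  : 'M[R]_#|S| :=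
  \matrix_(i, j) ((if i == j then (ideg e S (enum_val i))%:R else 0)
                  + (e (enum_val i) (enum_val j))%:R).

Definition iq (R : realType) (n : nat) (e : rel 'I_n) (S : {set 'I_n}) : R :=
  sup [set l : R | eigenvalue (isignless R e S) l].

(* Main.v *)
(* Let f be the unit Perron vector of Q(G[S]), m = |S|, q = q(G[S]), and let u
   minimise f.  Restricting f to S \ u and using the Rayleigh principle gives
   q(G[S \ u]) (1 - f(u)^2) >= q (1 - 2 f(u)^2) + m f(u)^2 - 1, while the eigen
   equation at a vertex of small degree d, with Cauchy-Schwarz, forces
   f(u)^2 <= d / (q^2 - 2 q d + m d).  Hence, as long as the minimum degree is
   at most (gamma - alpha) m, deleting u raises q / m by at least
   alpha beta / m, so q / m exceeds 1 + (alpha beta / 2) ln (n / m) along the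
   deletion process.  Since q / m <= 2, the process must stop while m > c n. *)
Require Import Defs.
From HB Require Import structures.
From mathcomp Require Import all_boot all_order all_algebra.
From mathcomp Require Import all_classical all_reals all_analysis.
From mathcomp Require Import ring lra.
Set Implicit Arguments. Unset Strict Implicit. Unset Printing Implicit Defensive.
Import Order.TTheory GRing.Theory Num.Theory.
Import numFieldNormedType.Exports.
Local Open Scope ring_scope.

(** * Quadratic forms and Perron vectors of nonnegative symmetric matrices *)

Lemma qformE (R : pzRingType) (k : nat) (M : 'M[R]_k) (x : 'rV[R]_k) :
  (x *m M *m x^T) 0 0 = \sum_j (\sum_i x 0 i * M i j) * x 0 j.
Proof. by rewrite mxE; apply: eq_bigr => j _; rewrite !mxE. Qed.

Lemma dotE (R : pzRingType) (k : nat) (x : 'rV[R]_k) :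
  (x *m x^T) 0 0 = \sum_i x 0 i * x 0 i.
Proof. by rewrite mxE; apply: eq_bigr => j _; rewrite !mxE. Qed.

Lemma dot_ge0 (R : realDomainType) (k : nat) (x : 'rV[R]_k) :
  0 <= (x *m x^T) 0 0.
Proof. by rewrite dotE sumr_ge0 // => i _; rewrite -expr2 sqr_ge0. Qed.

Lemma dot_eq0 (R : realDomainType) (k : nat) (x : 'rV[R]_k) :
  (x *m x^T) 0 0 = 0 -> x = 0.
Proof.
rewrite dotE => /eqP; rewrite psumr_eq0 => [/allP h|i _]; last first.
  by rewrite -expr2 sqr_ge0.
apply/rowP => i; rewrite mxE; apply/eqP; rewrite -sqrf_eq0 expr2.
exact: h (mem_index_enum i).
Qed.

(** If [a > 0], the choice [t = a / (b + 1)] makes the expression negative; the [+ 1] covers the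
    case [b = 0]. *)
Lemma linear_coef_le0 (R : realFieldType) (a b : R) :
  0 <= b -> (forall t, 0 <= - (2 * t) * a + t ^+ 2 * b) -> a <= 0.
Proof.
move=> b0 key; rewrite leNgt; apply/negP => a1.
have b1 : 0 < b + 1 by lra.
have := key (a / (b + 1)).
have -> : - (2 * (a / (b + 1))) * a + (a / (b + 1)) ^+ 2 * b
  = - ((a / (b + 1)) ^+ 2 * (b + 2)) by field; lra.
have : 0 < (a / (b + 1)) ^+ 2 * (b + 2).
  by rewrite mulr_gt0 ?exprn_gt0 ?divr_gt0 //; lra.
by lra.
Qed.

(* First variation of the form along x - t x G. *)
Lemma psd_form_kernel (R : realFieldType) (k : nat) (G : 'M[R]_k) (x : 'rV[R]_k) :
  G^T = G -> (forall y : 'rV_k, 0 <= (y *m G *m y^T) 0 0) ->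
  (x *m G *m x^T) 0 0 = 0 -> x *m G = 0.
Proof.
move=> symG psd x0; set u := x *m G.
have xu : (x *m G *m u^T) = u *m u^T by [].
have ux : (u *m G *m x^T) = u *m u^T.
  by rewrite /u trmx_mul symG !mulmxA.
have key t : 0 <= - (2 * t) * (u *m u^T) 0 0 + t ^+ 2 * (u *m G *m u^T) 0 0.
  have := psd (x - t *: u).
  have -> : (x - t *: u)^T = x^T - t *: u^T by rewrite linearB linearZ.
  rewrite !mulmxBl !mulmxBr -!scalemxAl -!scalemxAr xu ux.
  have -> : x *m G *m x^T = 0.
    by apply/matrixP => i j; rewrite !ord1 x0 mxE.
  rewrite !mxE; set a := \sum_j _; set b := \sum_j _.
  by move=> h; apply: le_trans h _; rewrite le_eqVlt; apply/orP; left; apply/eqP; ring.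
apply: dot_eq0; apply/eqP; rewrite eq_le dot_ge0 andbT.
exact: linear_coef_le0 (psd u) key.
Qed.

Lemma continuous_qform (R : realType) (k : nat) (M : 'M[R]_k) :
  continuous (fun x : 'rV[R]_k => (x *m M *m x^T) 0 0).
Proof.
have -> : (fun x : 'rV[R]_k => (x *m M *m x^T) 0 0) =
    (fun x => \sum_j (\sum_i x 0 i * M i j) * x 0 j).
  by apply/funext => x; exact: qformE.
have cadd : continuous (fun x : R * R => x.1 + x.2) by exact: add_continuous.
have coord i : continuous (fun x : 'rV[R]_k => x 0 i) by exact: coord_continuous.
have clin j : continuous (fun x : 'rV[R]_k => \sum_i x 0 i * M i j).
  apply: continuous_big => // i _ x.
  by apply: (cvgM (F := nbhs x)); [exact: coord|exact: cvg_cst].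
apply: continuous_big => // j _ x.
by apply: (cvgM (F := nbhs x)); [exact: clin|exact: coord].
Qed.

Lemma compact_sphere (R : realType) (k : nat) :
  compact [set x : 'rV[R]_k | (x *m x^T) 0 0 = 1]%classic.
Proof.
have cube := @rV_compact R k (fun=> `[-1, 1]%classic)
  (fun=> @segment_compact R (-1) 1).
apply: (subclosed_compact _ cube).
- apply: (@preimage_closed _ _ (fun x : 'rV[R]_k => (x *m x^T) 0 0) [set x | x = 1]%classic).
    move=> x _; have := @continuous_qform R k 1%:M x.
    by under eq_fun do rewrite mulmx1.
  exact: closed_eq.
- move=> x /=; rewrite dotE => x1 i.
  have : x 0 i * x 0 i <= 1.
    rewrite -x1 (bigD1 i) //= lerDl sumr_ge0 // => j _.
    by rewrite -expr2 sqr_ge0.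
  by rewrite in_itv /= => h; apply/andP; split; nra.
Qed.

(** The form attains its maximum [l] on the compact unit sphere; scaling turns this into the
    Rayleigh bound for all [y]. *)
Lemma nonneg_sym_perron (R : realType) (k : nat) (M : 'M[R]_k) :
  (0 < k)%N -> M^T = M -> (forall i j, 0 <= M i j) ->
  exists (l : R) (x : 'rV[R]_k),
    [/\ forall i, 0 <= x 0 i, \sum_i x 0 i * x 0 i = 1, x *m M = l *: x
      & forall y : 'rV_k, (y *m M *m y^T) 0 0 <= l * (y *m y^T) 0 0].
Proof.
case: k M => // k M _ symM M0.
have [|z zS zmax] := EVT_max_rV _ (@compact_sphere R k.+1)
    (@continuous_subspaceT _ _ _ _ (@continuous_qform R k.+1 M)).
  exists (delta_mx 0 0) => /=; rewrite dotE (bigD1 0) //= big1 ?addr0 => [|i i0].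
    by rewrite !mxE !eqxx mulr1.
  by rewrite !mxE (negbTE i0) andbF mulr0.
move: zS; rewrite inE /= => z1.
set l : R := (z *m M *m z^T) 0 0 in zmax.
have ray (y : 'rV[R]_k.+1) : (y *m M *m y^T) 0 0 <= l * (y *m y^T) 0 0.
  have := dot_ge0 y; rewrite le_eqVlt => /predU1P[y0|y0].
    by rewrite -y0 mulr0 (dot_eq0 (esym y0)) !mul0mx mxE.
  set d : R := (y *m y^T) 0 0 in y0 *.
  set r := Num.sqrt d.
  have r0 : 0 < r by rewrite sqrtr_gt0.
  have rr : r * r = d by rewrite -expr2 sqr_sqrtr // ltW.
  have scal (A : 'M[R]_k.+1) :
      ((r^-1 *: y) *m A *m (r^-1 *: y)^T) 0 0 = d^-1 * (y *m A *m y^T) 0 0.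
    by rewrite linearZ /= -!scalemxAl -scalemxAr !mxE mulrA -invfM rr.
  have := zmax (r^-1 *: y); rewrite scal inE /=.
  have := scal 1%:M; rewrite !mulmx1 => ->; rewrite mulVf ?gt_eqF // => /(_ erefl).
  by rewrite mulrC ler_pdivrMr.
(* Taking absolute values keeps the norm and, as [M] has nonnegative entries, cannot lower the form,
   so [x] is again a maximiser. *)
pose x : 'rV[R]_k.+1 := \row_i `|z 0 i|.
have x1 : (x *m x^T) 0 0 = 1.
  rewrite -z1 !dotE; apply: eq_bigr => i _; rewrite !mxE.
  by rewrite -normrM ger0_norm // -expr2 sqr_ge0.
have xl : (x *m M *m x^T) 0 0 = l.
  apply/eqP; rewrite eq_le; apply/andP; split.
    by have := ray x; rewrite x1 mulr1.
  rewrite /l !qformE; apply: ler_sum => j _; rewrite !mulr_suml.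
  apply: ler_sum => i _; rewrite !mxE.
  by rewrite (le_trans (ler_norm _)) // !normrM (ger0_norm (M0 _ _)).
exists l, x; split => //.
- by move=> i; rewrite mxE.
- by rewrite -dotE.
(* The form of [l%:M - M] is nonnegative by [ray] and vanishes at [x], so [x] lies in its kernel. *)
suff : x *m (l%:M - M) = 0.
  by rewrite mulmxBr mul_mx_scalar => /eqP; rewrite subr_eq0 => /eqP.
apply: psd_form_kernel.
- by rewrite linearB /= tr_scalar_mx symM.
- move=> y; rewrite mulmxBr mulmxBl mul_mx_scalar -scalemxAl.
  by have := ray y; rewrite !mxE subr_ge0.
- rewrite mulmxBr mulmxBl mul_mx_scalar -scalemxAl.
  by move: x1 xl; rewrite !mxE => -> ->; rewrite mulr1 subrr.
Qed.

(** * The signless Laplacian of an induced subgraph *)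

(** The Rayleigh bound caps every eigenvalue by [l], and [l] is one itself, so the supremum in [iq]
    is a genuine maximum. *)
Lemma iq_max_eigenvalue (R : realType) (n : nat) (e : rel 'I_n) (S : {set 'I_n})
    (l : R) (x : 'rV[R]_#|S|) :
  x != 0 -> x *m isignless R e S = l *: x ->
  (forall y : 'rV_#|S|,
     (y *m isignless R e S *m y^T) 0 0 <= l * (y *m y^T) 0 0) ->
  iq R e S = l.
Proof.
move=> x0 xl ray.
have lev : eigenvalue (isignless R e S) l by apply/eigenvalueP; exists x.
have lub : ubound [set m : R | eigenvalue (isignless R e S) m]%classic l.
  move=> m /= /eigenvalueP[y ym y0].
  have y1 : 0 < (y *m y^T) 0 0.
    rewrite lt_def dot_ge0 andbT; apply: contra_neq y0; exact: dot_eq0.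
  by have := ray y; rewrite ym -scalemxAl [X in X <= _]mxE ler_pM2r.
apply/eqP; rewrite eq_le; apply/andP; split.
  by apply: ge_sup lub; exists l.
by apply: ub_le_sup => //; exists l.
Qed.

Lemma isignless_mul (R : realType) (n : nat) (e : rel 'I_n) (S : {set 'I_n})
    (f : 'I_n -> R) (j : 'I_#|S|) : symmetric e ->
  \sum_i f (enum_val i) * isignless R e S i j =
  (ideg e S (enum_val j))%:R * f (enum_val j)
  + \sum_(u in S) (e (enum_val j) u)%:R * f u.
Proof.
move=> symE; under eq_bigr do rewrite mxE mulrDr.
rewrite big_split /=; congr (_ + _).
  rewrite (bigD1 j) //= eqxx big1 ?addr0 => [|i ij]; first by rewrite mulrC.
  by rewrite (negbTE ij) mulr0.
rewrite [RHS]big_enum_val; apply: eq_bigr => i _.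
by rewrite mulrC symE.
Qed.

(** Vectors become functions on all vertices, so that one [f] can be tested on both [S] and
    [S :\ u]. *)
Lemma iq_perron (R : realType) (n : nat) (e : rel 'I_n) (S : {set 'I_n}) :
  symmetric e -> (0 < #|S|)%N ->
  (exists f : 'I_n -> R,
    [/\ forall v, 0 <= f v, \sum_(v in S) f v ^+ 2 = 1
      & forall v, v \in S -> iq R e S * f v =
          (ideg e S v)%:R * f v + \sum_(u in S) (e v u)%:R * f u])
  /\ (forall g : 'I_n -> R,
       \sum_(v in S) ((ideg e S v)%:R * g v + \sum_(u in S) (e v u)%:R * g u) * g v
       <= iq R e S * \sum_(v in S) g v ^+ 2).
Proof.
move=> symE S0; have symM : (isignless R e S)^T = isignless R e S.
  apply/matrixP => i j; rewrite !mxE symE eq_sym.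
  by case: eqP => [->|].
have M0 i j : 0 <= isignless R e S i j.
  by rewrite mxE addr_ge0 // ?ler0n //; case: ifP => // _; rewrite ler0n.
have [l [x [x0 x1 xl ray]]] := nonneg_sym_perron S0 symM M0.
have xN0 : x != 0.
  apply/eqP => xE; move: x1; rewrite xE big1 => [/esym/eqP|i _].
    by rewrite oner_eq0.
  by rewrite mxE mulr0.
rewrite (iq_max_eigenvalue xN0 xl ray); split.
  (* At most one index contributes: this is [x] extended by 0 outside [S]. *)
  pose f v := \sum_(i | enum_val i == v) x 0 i.
  have fE i : f (enum_val i) = x 0 i.
    rewrite /f (big_pred1 i) // => j /=.
    by rewrite (inj_eq enum_val_inj).
  exists f; split.
  - by move=> v; apply: sumr_ge0.
  - by rewrite big_enum_val -x1; apply: eq_bigr => i _; rewrite fE expr2.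
  - move=> v vS; rewrite -(enum_rankK_in vS vS).
    rewrite -isignless_mul // fE; move/rowP : xl => /(_ (enum_rank_in vS v)).
    by rewrite !mxE => <-; apply: eq_bigr => i _; rewrite fE.
move=> g; have := ray (\row_i g (enum_val i)).
rewrite qformE dotE => h; rewrite [leLHS]big_enum_val.
rewrite [X in _ * X]big_enum_val; move: h; congr (_ <= l * _).
  apply: eq_bigr => j _; rewrite mxE -isignless_mul //; congr (_ * _).
  by apply: eq_bigr => i _; rewrite mxE.
by apply: eq_bigr => i _; rewrite mxE expr2.
Qed.

(** * Deleting one vertex *)

(** Lagrange's identity: the difference of the two sides is half the double sum of
    [c i * c j * (f i - f j) ^+ 2]. *)
Lemma weighted_cauchy_schwarz (R : realDomainType) (I : finType) (A : {set I})
    (c f : I -> R) : (forall i, 0 <= c i) ->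
  (\sum_(i in A) c i * f i) ^+ 2 <=
  (\sum_(i in A) c i) * \sum_(i in A) c i * f i ^+ 2.
Proof.
move=> c0; set T := \sum_(i in A) c i * f i; set C := \sum_(i in A) c i.
set F := \sum_(i in A) _.
have : 0 <= \sum_(i in A) \sum_(j in A) c i * c j * (f i - f j) ^+ 2.
  by do 2!apply: sumr_ge0 => ? _; rewrite mulr_ge0 ?sqr_ge0 ?mulr_ge0.
have -> : \sum_(i in A) \sum_(j in A) c i * c j * (f i - f j) ^+ 2 =
    F * C + C * F - (T * T + T * T).
  rewrite /F /C /T !big_distrlr /= -!big_split -sumrB /=.
  apply: eq_bigr => i _; rewrite -!big_split -sumrB /=.
  by apply: eq_bigr => j _; ring.
by nra.
Qed.

Lemma ideg_sum (R : pzSemiRingType) (n : nat) (e : rel 'I_n) (S : {set 'I_n})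
    (v : 'I_n) : (ideg e S v)%:R = \sum_(u in S) (e v u)%:R :> R.
Proof.
rewrite /ideg cardE -natr_sum; congr (_%:R).
rewrite -cardE -sum1_card big_mkcond [RHS]big_mkcond /=.
by apply: eq_bigr => u _; rewrite inE; case: (u \in S); case: (e v u).
Qed.

(** At a vertex [w] maximising [f], the eigen equation gives [q * f w <= 2 * d * f w], where
    [d <= #|S|] is the degree of [w]. *)
Lemma iq_le (R : realType) (n : nat) (e : rel 'I_n) (S : {set 'I_n}) :
  symmetric e -> (0 < #|S|)%N -> iq R e S <= 2 * (#|S|)%:R.
Proof.
move=> symE S0; have [[f [f0 f1 fE]] _] := iq_perron R symE S0.
have [v0 v0S] := card_gt0P S0.
case: (Order.TotalTheory.arg_maxP f v0S) => w wS wmax.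
have dw : (ideg e S w)%:R <= (#|S|)%:R :> R.
  by rewrite ler_nat /ideg subset_leq_card //; apply/fintype.subsetP => u; rewrite inE => /andP[].
have fw : 0 < f w.
  rewrite lt_def f0 andbT; apply/eqP => w0.
  have fv0 v : v \in S -> f v = 0.
    by move=> vS; apply/eqP; rewrite eq_le f0 andbT -w0; exact: wmax.
  move/eqP: f1; rewrite big1 => [|v vS]; last by rewrite fv0 // expr0n.
  by rewrite eq_sym oner_eq0.
have : \sum_(u in S) (e w u)%:R * f u <= (ideg e S w)%:R * f w.
  rewrite ideg_sum mulr_suml; apply: ler_sum => u uS.
  by rewrite ler_wpM2l ?ler0n //; exact: wmax.
by have := fE _ wS; nra.
Qed.

Lemma iq_remove_vertex (R : realType) (n : nat) (e : rel 'I_n) (S : {set 'I_n}) :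
  simple_graph e -> (1 < #|S|)%N ->
  exists2 u, u \in S & exists z : R,
    [/\ 0 <= z, (#|S|)%:R * z <= 1,
      iq R e S * (1 - 2 * z) + (#|S|)%:R * z - 1 <= iq R e (S :\ u) * (1 - z)
    & forall w, w \in S -> (ideg e S w)%:R <= iq R e S ->
        z * ((iq R e S - (ideg e S w)%:R) ^+ 2
             + (ideg e S w)%:R * ((#|S|)%:R - (ideg e S w)%:R))
        <= (ideg e S w)%:R].
Proof.
move=> [symE irrE] S1; have S0 := ltnW S1.
have [[f [f0 f1 fE]] _] := iq_perron R symE S0.
have [v0 v0S] := card_gt0P S0.
case: (Order.TotalTheory.arg_minP f v0S) => u uS umin.
have {}uS : u \in S by [].
have {}umin v : v \in S -> f u ^+ 2 <= f v ^+ 2.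
  by move=> vS; rewrite ler_pXn2r ?nnegrE //; exact: umin.
(* Each of the [m - d] vertices of [S] not adjacent to [w] carries weight at least [f u ^+ 2] out of
   the total 1. *)
have nbr w : \sum_(v in S) (e w v)%:R * f v ^+ 2
    <= 1 - ((#|S|)%:R - (ideg e S w)%:R) * f u ^+ 2.
  rewrite -[X in _ <= X - _]f1 lerBrDr -lerBrDl -sumrB ideg_sum -sum1_card natr_sum -sumrB mulr_suml.
  apply: ler_sum => v vS; rewrite -[X in X - _ * _]mul1r -mulrBl ler_wpM2l ?umin //.
  by case: (e w v); rewrite ?subrr // subr0.
exists u => //; exists (f u ^+ 2); split.
- exact: sqr_ge0.
- rewrite -[leRHS]f1 -sum1_card natr_sum mulr_suml; apply: ler_sum => v vS.
  by rewrite mul1r umin.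
- have S'0 : (0 < #|S :\ u|)%N by move: S1; rewrite (cardsD1 u) uS.
  have [_ /(_ f)] := iq_perron R symE S'0.
  have f1' : \sum_(v in S :\ u) f v ^+ 2 = 1 - f u ^+ 2.
    by rewrite -[X in X - _]f1 (big_setD1 u uS) /= addrC addrK.
  rewrite f1'; apply: le_trans.
  (* Deleting [u] lowers the degree of [v] by [e u v] and removes the term [f u] from its neighbour
     sum. *)
  have -> : \sum_(v in S :\ u) ((ideg e (S :\ u) v)%:R * f v
        + \sum_(w in S :\ u) (e v w)%:R * f w) * f v =
      \sum_(v in S :\ u) (iq R e S * f v ^+ 2
        - ((e u v)%:R * f v ^+ 2 + f u * ((e u v)%:R * f v))).
    apply: eq_bigr => v; rewrite !inE => /andP[_ vS].
    move: (fE v vS); rewrite !ideg_sum !(big_setD1 u uS) /= (symE v u) => h.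
    by rewrite expr2 [iq R e S * _]mulrA h; ring.
  rewrite sumrB -mulr_sumr f1' big_split -mulr_sumr /=.
  have drop (F : 'I_n -> R) :
      \sum_(v in S :\ u) (e u v)%:R * F v = \sum_(v in S) (e u v)%:R * F v.
    by rewrite [RHS](big_setD1 u uS) /= irrE mul0r add0r.
  rewrite (drop (fun v => f v ^+ 2)) (drop f).
  by have := nbr u; have := fE u uS; set A := \sum_(v in S) _ * f v; nra.
- move=> w wS dq; have uw : f u <= f w.
    by rewrite -(@ler_pXn2r _ 2) ?nnegrE // umin.
  (* By the eigen equation the neighbour sum at [w] is [(q - d) * f w]; then [nbr] bounds the other
     side and [f w ^+ 2 >= z]. *)
  have CS := @weighted_cauchy_schwarz R _ S (fun v => (e w v)%:R) f (fun=> ler0n _ _).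
  move: CS; rewrite -ideg_sum.
  have -> : \sum_(v in S) (e w v)%:R * f v = (iq R e S - (ideg e S w)%:R) * f w.
    by rewrite mulrBl (fE w wS) addrC addKr.
  rewrite exprMn => CS.
  have := nbr w; move: CS; set F := \sum_(v in S) _; move=> CS hF.
  have d0 : 0 <= (ideg e S w)%:R :> R by exact: ler0n.
  have := ler_wpM2l d0 hF; have := umin w wS.
  have := sqr_ge0 (iq R e S - (ideg e S w)%:R).
  by nra.
Qed.

(* Here t = q / m, a = m z and D = d / m; the loss in q / m is governed by
   t a + 1 - a = t - (t - 1) (1 - a). *)
Lemma density_gain (R : realFieldType) (alpha beta q q' m d z : R) :
  0 < alpha -> alpha <= 2 / 3 -> 0 < beta -> beta < 1 / 2 ->
  2 <= alpha * beta * m -> q <= 2 * m -> (1 + 19 / 10 * beta) * m <= q ->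
  0 <= d -> 19 / 10 * alpha * m <= q - 2 * d ->
  0 <= z -> m * z <= 1 ->
  z * ((q - d) ^+ 2 + d * (m - d)) <= d ->
  q * (1 - 2 * z) + m * z - 1 <= q' * (1 - z) ->
  (q + alpha * beta) / m <= q' / (m - 1).
Proof.
move=> a0 a1 b0 b1 km qm tb d0 ta z0 mz hz hq.
set k := alpha * beta in km *.
have k0 : 0 < k by rewrite mulr_gt0.
have k1 : k <= 1 / 3 by rewrite /k; nra.
have m0 : 0 < m by nra.
have m6 : 6 <= m by nra.
have z1 : z < 1 by nra.
pose t := q / m; have qE : q = t * m by rewrite /t divfK // gt_eqF.
pose D := d / m; have dE : d = D * m by rewrite /D divfK // gt_eqF.
set a := m * z in mz *.
have t2 : t <= 2 by rewrite ler_pdivrMr.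
have t1 : 1 + 19 / 10 * beta <= t by rewrite ler_pdivlMr.
have D0 : 0 <= D by rewrite divr_ge0 // ltW.
have tD : 19 / 10 * alpha <= t - 2 * D.
  by rewrite -(ler_pM2r m0); move: ta; rewrite qE dE; lra.
have A0 : 0 <= a by rewrite mulr_ge0 // ltW.
(* This is the bound on [z] divided by [m]. *)
have hA : a * (t * (t - 2 * D) + D) <= D.
  rewrite -(ler_pM2r m0) -[leRHS]dE; apply: le_trans hz.
  by rewrite le_eqVlt /a qE dE; apply/orP; left; apply/eqP; ring.
(* Here [hA] gives [a * t * (t - 2 * D) <= D * (1 - a)], and [D <= t / 2]; divide by [t]. *)
have hs : a * (t - 2 * D) <= (1 - a) / 2.
  have : 0 <= (1 - a) * (t / 2 - D) by rewrite mulr_ge0; lra.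
  have t0 : 0 < t by lra.
  by move=> h; rewrite -(ler_pM2l t0); lra.
(* Solving for [1 - a] gives at least [3.8 * alpha / (1 + 3.8 * alpha)], which exceeds
   [1.07 * alpha] because [alpha <= 2 / 3]. *)
have h1a : 107 / 100 * alpha <= 1 - a.
  have : a * (19 / 10 * alpha) <= a * (t - 2 * D) by rewrite ler_wpM2l.
  have : 0 <= (1 - a) * (2 / 3 - alpha) by rewrite mulr_ge0; lra.
  by lra.
(* The constants fit because [1.9 * 1.07 > 2]. One [k] becomes the increase in [q'ge], the other
   pays for [t * z]. *)
have gain : 2 * k <= (t - 1) * (1 - a).
  have : (19 / 10 * beta) * (107 / 100 * alpha) <= (t - 1) * (1 - a).
    by apply: ler_pM; lra.
  by rewrite /k; nra.
have tz : t * z <= k.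
  have : t * a <= 2 * 1 by apply: ler_pM; lra.
  by move=> h; rewrite -(ler_pM2r m0); move: h; rewrite /a; lra.
have q'ge : q - t + k <= q'.
  have z1' : 0 < 1 - z by lra.
  rewrite -(ler_pM2r z1'); apply: le_trans hq.
  have : 0 <= k * z by rewrite mulr_ge0 // ltW.
  have qz : q * z = t * a by rewrite qE /a; ring.
  by rewrite -/a; lra.
rewrite ler_pdivrMr // mulrAC ler_pdivlMr; last by lra.
have : (q - t + k) * m <= q' * m by rewrite ler_pM2r.
by rewrite qE; lra.
Qed.

Lemma exists_ideg_le (R : realDomainType) (n : nat) (e : rel 'I_n)
    (S : {set 'I_n}) (x : R) : (0 < #|S|)%N ->
  (imindeg e S)%:R <= x -> exists2 w, w \in S & (ideg e S w)%:R <= x.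
Proof.
move=> S0 hx; have [/existsP[w /andP[wS wx]]|/existsPn h] :=
    boolP [exists w, (w \in S) && ((ideg e S w)%:R <= x)]; first by exists w.
have {}h w : w \in S -> x < (ideg e S w)%:R.
  by move=> wS; have := h w; rewrite wS ltNge.
(* The fold in [imindeg] starts from the default [#|S|], which must exceed [x] too; it does, being
   at least any degree in [S]. *)
suff : x < (imindeg e S)%:R by rewrite ltNge hx.
apply: (big_ind (fun k : nat => x < k%:R)) => //.
- have [w wS] := card_gt0P S0; apply: lt_le_trans (h w wS) _.
  rewrite ler_nat /ideg subset_leq_card //.
  by apply/fintype.subsetP => u; rewrite inE => /andP[].
- by move=> i j xi xj; rewrite /minn; case: ifP.
Qed.

(** The factors [19 / 10] in place of 2 leave room for the deficit [s / n] of the initial graph. *)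
Lemma iq_density_step (R : realType) (alpha beta : R) (n : nat) (e : rel 'I_n)
    (S : {set 'I_n}) (w : 'I_n) :
  simple_graph e ->
  0 < alpha -> alpha <= 2 / 3 -> 0 < beta -> beta < 1 / 2 ->
  2 <= alpha * beta * (#|S|)%:R ->
  (1 + 19 / 10 * beta) * (#|S|)%:R <= iq R e S -> w \in S ->
  19 / 10 * alpha * (#|S|)%:R <= iq R e S - 2 * (ideg e S w)%:R ->
  exists2 u, u \in S &
    (iq R e S + alpha * beta) / (#|S|)%:R
    <= iq R e (S :\ u) / (#|S :\ u|)%:R.
Proof.
move=> simE a0 a1 b0 b1 km tb wS ta.
have k1 : alpha * beta < 1 / 2 by nra.
have k0 : 0 < alpha * beta by rewrite mulr_gt0.
have S2 : (1 < #|S|)%N by rewrite -(ltr_nat R); nra.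
have d0 : 0 <= (ideg e S w)%:R :> R by exact: ler0n.
have [u uS [z [z0 mz hq hz]]] := iq_remove_vertex R simE S2.
exists u => //.
have -> : (#|S :\ u|)%:R = (#|S|)%:R - 1 :> R.
  by rewrite (cardsD1 u S) uS natrD addrAC subrr add0r.
apply: (@density_gain _ alpha beta _ _ _ (ideg e S w)%:R z) => //.
  by apply: iq_le (ltnW S2); case: simE.
by apply: hz => //; nra.
Qed.

(** * Logarithmic estimates *)

(** From [ln (1 / 2) <= - 1 / 2] one gets [ln 2 >= 1 / 2], and 6 exceeds 4. *)
Lemma ln6_ge1 (R : realType) : 1 <= ln (6 : R).
Proof.
have h : ln (1 + - (1 / 2)) <= - (1 / 2) :> R by apply: le_ln1Dx; lra.
have l2 : ln (1 + - (1 / 2)) = - ln 2 :> R.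
  by rewrite -lnV ?posrE //; congr ln; field.
have -> : (6 : R) = 2 * 2 * (3 / 2) by field.
have p2 : (2 : R) \is Num.pos by rewrite posrE; lra.
have p3 : (3 / 2 : R) \is Num.pos by rewrite posrE; lra.
have p4 : (2 * 2 : R) \is Num.pos by rewrite posrE; lra.
rewrite lnM // [ln (2 * 2)]lnM //.
have : 0 <= ln (3 / 2 : R) by apply: ln_ge0; lra.
by move: h; rewrite l2; lra.
Qed.

(** Otherwise [ln (n / m) >= 3 / k * ln 6], and the density would be at least
    [1 + 3 / 2 * ln 6 >= 5 / 2], above its bound 2. *)
Lemma size_of_density (R : realType) (k m n q : R) :
  0 < k -> 0 < m -> 0 < n -> q <= 2 * m ->
  1 + k / 2 * ln (n / m) <= q / m -> (6 : R) `^ (- (3 / k)) * n < m.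
Proof.
move=> k0 m0 n0 qm hq; rewrite ltNge; apply/negP => mn.
have p0 : 0 < (6 : R) `^ (- (3 / k)) by rewrite powR_gt0.
have : ln ((6 : R) `^ (- (3 / k)))^-1 <= ln (n / m).
  rewrite ler_ln ?posrE ?invr_gt0 ?divr_gt0 //.
  by rewrite ler_pdivlMr // ler_pdivrMl.
rewrite lnV ?posrE // ln_powR mulNr opprK => h.
have : q / m <= 2 by rewrite ler_pdivrMr.
have : k / 2 * (3 / k * ln 6) <= k / 2 * ln (n / m) by rewrite ler_wpM2l // ltW ?divr_gt0.
have -> : k / 2 * (3 / k * ln 6) = 3 / 2 * ln 6 by field; lra.
by have := ln6_ge1 R; lra.
Qed.

(** Apply [ln (1 + y) <= y] to [y = 1 / (m - 1) <= 2 / m]. Multiplied by [k / 2], the increment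
    [2 / m] is exactly the density gain [k / m] of one deletion. *)
Lemma ln_div_pred (R : realType) (n m : R) : 0 < n -> 2 <= m ->
  ln (n / (m - 1)) <= ln (n / m) + 2 / m.
Proof.
move=> n0 m2; have m1 : 0 < m - 1 by lra.
have m0 : 0 < m by lra.
have -> : n / (m - 1) = n / m * (1 + (m - 1)^-1) by field; lra.
rewrite lnM ?posrE ?divr_gt0 // ?addr_gt0 ?invr_gt0 // lerD2l.
have i0 : 0 < (m - 1)^-1 by rewrite invr_gt0.
apply: (le_trans (le_ln1Dx _)); first by lra.
by rewrite -div1r ler_pdivrMr // mulrAC ler_pdivlMr //; lra.
Qed.

(** * Iterated deletion *)

(** [N] stays fixed as the initial order while [S] shrinks. The logarithmic invariant keeps [#|S|]
    above [c * N], hence large enough for a further deletion. *)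
Lemma exists_mindeg_subset (R : realType) (alpha beta gamma N : R) (n : nat) (e : rel 'I_n) :
  0 < alpha -> alpha <= 2 / 3 -> 0 < beta -> beta < 1 / 2 ->
  1 / 2 + beta <= gamma -> 0 < N -> simple_graph e ->
  let c := (6 : R) `^ (- (3 / (alpha * beta))) in
  2 <= alpha * beta * (c * N) ->
  forall S : {set 'I_n}, (0 < #|S|)%N ->
    2 * gamma * (#|S|)%:R < iq R e S ->
    1 + alpha * beta / 2 * ln (N / (#|S|)%:R) <= iq R e S / (#|S|)%:R ->
    exists T : {set 'I_n},
      [/\ (#|T|%:R > c * N),
          iq R e T > 2 * gamma * (#|T|)%:R
        & (imindeg e T)%:R > (gamma - alpha) * (#|T|)%:R].
Proof.
move=> a0 a1 b0 b1 bg N0 simE c cN S.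
have k0 : 0 < alpha * beta by rewrite mulr_gt0.
have k1 : alpha * beta < 1 / 2 by nra.
(* Induction on an upper bound [p] for the size of [S]. *)
move: {2}#|S| (leqnn #|S|) => p; elim: p S => [|p IH] S.
  by rewrite leqn0 => /eqP ->.
move=> Sp S0 hq hln.
have m0 : 0 < (#|S|)%:R :> R by rewrite ltr0n.
have size : c * N < (#|S|)%:R.
  by apply: size_of_density hln => //; apply: iq_le => //; case: simE.
have [hd|hd] := ltP ((gamma - alpha) * (#|S|)%:R) (imindeg e S)%:R.
  by exists S.
have [w wS dw] := exists_ideg_le S0 hd.
have km : 2 <= alpha * beta * (#|S|)%:R.
  by apply: le_trans cN _; rewrite ler_wpM2l // ltW.
have [] := @iq_density_step R alpha beta n e S w simE a0 a1 b0 b1 km _ wS _.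
- by nra.
- by nra.
move=> u uS hu.
have m2 : 2 <= (#|S|)%:R :> R by nra.
have cS : #|S| = (#|S :\ u|).+1 by rewrite (cardsD1 u S) uS.
have cSR : (#|S :\ u|)%:R = (#|S|)%:R - 1 :> R by rewrite cS -natr1 addrK.
have m'0 : 0 < (#|S :\ u|)%:R :> R by rewrite cSR; lra.
have km0 : 0 < alpha * beta / (#|S|)%:R by rewrite divr_gt0.
rewrite mulrDl in hu.
apply: (IH (S :\ u)).
- by rewrite -ltnS -cS.
- by rewrite -(ltr_nat R).
- rewrite -ltr_pdivlMr //; apply: lt_le_trans hu.
  by move: hq; rewrite -ltr_pdivlMr //; lra.
- apply: le_trans hu; rewrite cSR.
  have := ln_div_pred N0 m2; rewrite -(ler_pM2l (_ : 0 < alpha * beta / 2)); last by lra.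
  by lra.
Qed.

(** * The first deletion, absorbing the error term [s / n] *)

Theorem theorem3p3 (R : realType) (alpha beta gamma s : R) :
  0 < alpha -> alpha <= 2 / 3 ->
  0 < beta -> beta < 1 / 2 ->
  alpha < gamma -> 1 / 2 + beta <= gamma -> gamma < 1 ->
  0 <= s ->
  let c := (6 : R) `^ (- (3 / (alpha * beta))) in
  exists n0 : nat, forall n : nat, (n0 <= n)%N ->
    forall e : rel 'I_n, simple_graph e ->
      iq R e [set: 'I_n] > 2 * gamma * n%:R - s / n%:R ->
      (imindeg e [set: 'I_n])%:R <= (gamma - alpha) * n%:R ->
      exists S : {set 'I_n},
        [/\ (#|S|%:R > c * n%:R),
            iq R e S > 2 * gamma * (#|S|)%:R
          & (imindeg e S)%:R > (gamma - alpha) * (#|S|)%:R].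
Proof.
move=> a0 a1 b0 b1 ag bg g1 s0 c.
have k0 : 0 < alpha * beta by rewrite mulr_gt0.
have k1 : alpha * beta < 1 / 2 by nra.
have c0 : 0 < c by rewrite powR_gt0.
(* Each summand secures one of [h1] to [h5]; the final 1 secures [n > 1]. *)
pose B := 2 / (alpha * beta * c) + 2 / (alpha * beta)
  + 10 * s / alpha + 10 * s / beta + s / (alpha * beta) + 1.
have [B1 B2 B3] : [/\ 0 < 2 / (alpha * beta * c), 0 < 2 / (alpha * beta)
    & 0 <= 10 * s / alpha].
  by split; rewrite ?divr_gt0 ?mulr_gt0 // divr_ge0 ?mulr_ge0 // ltW.
have [B4 B5] : 0 <= 10 * s / beta /\ 0 <= s / (alpha * beta).
  by split; rewrite divr_ge0 ?mulr_ge0 // ltW.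
exists (Num.bound B) => n nB e simE hq hd.
have nB' : B < n%:R.
  apply: (@lt_le_trans _ _ (Num.bound B)%:R); last by rewrite ler_nat.
  by apply: archi_boundP; rewrite /B; lra.
have n1 : 1 < n%:R :> R by move: nB'; rewrite /B; lra.
have n0 : 0 < n%:R :> R by exact: lt_trans ltr01 n1.
have h1 : 2 <= alpha * beta * (c * n%:R).
  by rewrite mulrA mulrC -ler_pdivrMr ?mulr_gt0 //; move: nB'; rewrite /B; lra.
have h2 : 2 <= alpha * beta * n%:R.
  by rewrite [leRHS]mulrC -ler_pdivrMr //; move: nB'; rewrite /B; lra.
have h3 : 10 * s <= alpha * n%:R.
  by rewrite [leRHS]mulrC -ler_pdivrMr //; move: nB'; rewrite /B; lra.
have h4 : 10 * s <= beta * n%:R.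
  by rewrite [leRHS]mulrC -ler_pdivrMr //; move: nB'; rewrite /B; lra.
have h5 : s < alpha * beta * n%:R.
  by rewrite mulrC -ltr_pdivrMr //; move: nB'; rewrite /B; lra.
have sn : s / n%:R < alpha * beta by rewrite ltr_pdivrMr.
have sns : s / n%:R <= s by rewrite ler_pdivrMr //; nra.
have cT : #|[set: 'I_n]| = n by rewrite cardsT card_ord.
have T0 : (0 < #|[set: 'I_n]|)%N by rewrite cT -(ltr_nat R).
have [w _ dw] := exists_ideg_le T0 hd.
(* The whole graph may have density slightly below [2 * gamma], so one vertex is deleted before the
   iteration starts. *)
have [] := @iq_density_step R alpha beta n e [set: 'I_n] w simE a0 a1 b0 b1 _ _ (finset.in_setT w) _;
  rewrite ?cT //.
- by nra.
- by lra.
move=> u uT hu.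
have cuR : (#|[set: 'I_n] :\ u|)%:R = n%:R - 1 :> R.
  by rewrite -[in RHS]cT (cardsD1 u [set: 'I_n]) uT natrD addrAC subrr add0r.
have m'0 : 0 < (#|[set: 'I_n] :\ u|)%:R :> R by rewrite cuR; lra.
have n2 : 2 <= n%:R :> R by nra.
apply: (@exists_mindeg_subset R alpha beta gamma n%:R n e a0 a1 b0 b1 bg n0 simE h1 ([set: 'I_n] :\ u)).
- by rewrite -(ltr_nat R).
(* The gain [alpha * beta] in the numerator outweighs the deficit [s / n], by [sn]. *)
- rewrite -ltr_pdivlMr //; apply: lt_le_trans hu.
  by rewrite ltr_pdivlMr //; lra.
(* The logarithm starts from [ln (n / n) = 0], so the gain [alpha * beta] covers its first
   increment, and [q >= n] covers the constant 1. *)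
- apply: le_trans hu; rewrite cuR ler_pdivlMr //.
  have := ln_div_pred n0 n2; rewrite divff ?gt_eqF // ln1 add0r ler_pdivlMr // => hl.
  have : alpha * beta / 2 * (ln (n%:R / (n%:R - 1)) * n%:R) <= alpha * beta / 2 * 2.
    by rewrite ler_wpM2l //; lra.
  by nra.
Qed.
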